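(* The Boolean algebra $\mathfrak{T}_{\mathcal{V}}/\mathrm{Fin}$ has property ( * ).
   Context: Natural numbers are identified with the sets of their predecessors, $n=\{0,\dots,n-1\}$; in particular $2^n=\{0,\dots,2^n-1\}$. For $S\subseteq\omega\times\omega$ put $S(n)=\{m:(n,m)\in S\}$. Let $\mathcal{S}=\{S\subseteq\omega\times\omega: |S(n)|<2^n \text{ for all } n\}$ (the set of slaloms). Let $\mathcal{V}$ be the set of all $S\in\mathcal{S}$ such that $S(n)\subseteq 2^n$ for each $n$ and $\lim_n \frac{1}{2^n}|S(n)|=0$. Let $\Omega=\{(S,n): n\in\omega,\ S\in\mathcal{S},\ S\subseteq n\times 2^n\}$. For $A\subseteq\omega\times\omega$ let $T_A=\{(T,n)\in\Omega: A\cap(n\times 2^n)\subseteq T\}$. For $(S,n)\in\Omega$ let $T_{(S,n)}=\{(T,m)\in\Omega: m\geq n,\ T\cap(n\times 2^n)=S\}$. $\mathfrak{T}_{\mathcal{V}}$ is the subalgebra of $\mathcal{P}(\Omega)$ generated by $\{T_A: A\in\mathcal{V}\}\cup\{T_{(S,n)}:(S,n)\in\Omega\}$, and $\mathfrak{T}_{\mathcal{V}}/\mathrm{Fin}$ is its quotient by the ideal of its finite members. For a Boolean algebra $\mathfrak{A}$ let $\mathfrak{A}^+$ be the set of its nonzero elements. A family of elements is centered if each of its finite subsets has nonzero meet. $\mathfrak{A}$ has property ( * ) if $\mathfrak{A}^+=\bigcup_{n<\omega}\mathcal{C}_n$, where for each $n$ every infinite $\mathcal{C}\subseteq\mathcal{C}_n$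 contains an infinite centered subfamily. *)

(* Defs.v *)
From HB Require Import structures.
From mathcomp Require Import all_boot all_order all_algebra finmap.
From mathcomp Require Import generic_quotient.
From mathcomp Require Import all_classical all_reals all_analysis.
Import Order.TTheory GRing.Theory Num.Theory numFieldNormedType.Exports.

Set Implicit Arguments.
Unset Strict Implicit.
Unset Printing Implicit Defensive.

Local Open Scope classical_set_scope.

(* A Boolean algebra is a complemented distributive lattice with bottom and
   top, i.e. a [ctbDistrLatticeType]. *)

Definition centered d (B : ctbDistrLatticeType d) (E : set B) : Prop :=
  forall F : {fset B}, [set` F] `<=` E ->
    (\meet_(x <- F) x)%O != (\bot)%O :> B.

Definition property_star d (B : ctbDistrLatticeType d) : Prop :=
  exists C : nat -> set B,
    [set x : B | x != (\bot)%O] = \bigcup_n C n /\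
    forall (n : nat) (D : set B), D `<=` C n -> infinite_set D ->
      exists E : set B, [/\ E `<=` D, infinite_set E & centered E].

Definition algebra_of_sets T (M : set (set T)) : Prop :=
  [/\ M set0, setC_closed M & setU_closed M].

Section generated_algebra.
Context {T : Type} (G : set (set T)).

Definition gen_algebra : set (set T) := smallest (@algebra_of_sets T) G.

Lemma gen_algebraP : algebra_of_sets gen_algebra.
Proof.
split.
- by move=> M /= [[M0 _ _] _].
- by move=> A GA M MG; have [[_ MC _] _] := MG; apply: MC; apply: GA.
- move=> A B GA GB M MG; have [[_ _ MU] _] := MG.
  by apply: MU; [apply: GA | apply: GB].
Qed.

Lemma gen_algebra0 : gen_algebra set0. Proof. by case: gen_algebraP. Qed.

Lemma gen_algebraC A : gen_algebra A -> gen_algebra (~` A).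
Proof. by case: gen_algebraP => _ + _; apply. Qed.

Lemma gen_algebraU A B :
  gen_algebra A -> gen_algebra B -> gen_algebra (A `|` B).
Proof. by case: gen_algebraP => _ _; apply. Qed.

Lemma gen_algebraI A B :
  gen_algebra A -> gen_algebra B -> gen_algebra (A `&` B).
Proof.
move=> GA GB; rewrite -[A]setCK -[B]setCK -setCU.
by apply: gen_algebraC; apply: gen_algebraU; apply: gen_algebraC.
Qed.

Definition galg := {A : set T | A \in gen_algebra}.
HB.instance Definition _ := Choice.on galg.

Definition galg_mk (A : set T) (GA : gen_algebra A) : galg := exist _ A (mem_set GA).

Lemma galgP (a : galg) : gen_algebra (val a). Proof. exact/set_mem/(valP a). Qed.

Definition galg0 : galg := galg_mk gen_algebra0.
Definition galgC (a : galg) : galg := galg_mk (gen_algebraC (galgP a)).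
Definition galgU (a b : galg) : galg :=
  galg_mk (gen_algebraU (galgP a) (galgP b)).
Definition galgI (a b : galg) : galg :=
  galg_mk (gen_algebraI (galgP a) (galgP b)).

(* Equality modulo the ideal of finite members: the symmetric difference,
   itself a member of the algebra, is finite. *)
Definition eqfin (a b : galg) : bool := `[< finite_set (val a `+` val b) >].

Lemma eqfin_refl : reflexive eqfin.
Proof. by move=> a; apply/asboolP; rewrite setYK. Qed.

Lemma eqfin_sym : symmetric eqfin.
Proof. by move=> a b; rewrite /eqfin setYC. Qed.

Lemma eqfin_trans : transitive eqfin.
Proof.
move=> b a c /asboolP ab /asboolP bc; apply/asboolP.
have abc : finite_set ((val a `+` val b) `|` (val b `+` val c)).
  by rewrite finite_setU.
apply: sub_finite_set abc => x; rewrite /setY /= => -[[ax cx]|[cx ax]].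
- by have [bx|bx] := pselect (val b x); [right; left | left; left].
- by have [bx|bx] := pselect (val b x); [left; right | right; right].
Qed.

Canonical eqfin_equiv := EquivRel eqfin eqfin_refl eqfin_sym eqfin_trans.

Definition galgFin := {eq_quot eqfin}%qT.
HB.instance Definition _ := Choice.on galgFin.
HB.instance Definition _ := EqQuotient.on galgFin.

Local Notation cl := (\pi_galgFin)%qT.

Definition fin0 : galgFin := cl galg0.
Definition fin1 : galgFin := cl (galgC galg0).
Definition finC (x : galgFin) : galgFin := cl (galgC (repr x)).
Definition finU (x y : galgFin) : galgFin := cl (galgU (repr x) (repr y)).
Definition finI (x y : galgFin) : galgFin := cl (galgI (repr x) (repr y)).

Lemma clP (a b : galg) : cl a = cl b <-> finite_set (val a `+` val b).
Proof.
by split=> [/eqquotP/asboolP//|ab]; apply/eqquotP; apply/asboolP.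
Qed.

Lemma cl_val (a b : galg) : val a = val b -> cl a = cl b.
Proof. by move/val_inj => ->. Qed.

Lemma finite_repr (a : galg) : finite_set (val (repr (cl a)) `+` val a).
Proof. by apply/clP; rewrite reprK. Qed.

Lemma clC a : finC (cl a) = cl (galgC a).
Proof.
apply/clP; apply: sub_finite_set (finite_repr a) => x; rewrite /setY /=.
by move=> [[ax /contrapT cx]|[cx /contrapT ax]]; [right | left].
Qed.

Lemma clU a b : finU (cl a) (cl b) = cl (galgU a b).
Proof.
apply/clP.
have fab : finite_set ((val (repr (cl a)) `+` val a) `|`
                       (val (repr (cl b)) `+` val b)).
  by rewrite finite_setU; split; exact: finite_repr.
apply: sub_finite_set fab => x; rewrite /setY /=; tauto.
Qed.

Lemma clI a b : finI (cl a) (cl b) = cl (galgI a b).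
Proof.
apply/clP.
have fab : finite_set ((val (repr (cl a)) `+` val a) `|`
                       (val (repr (cl b)) `+` val b)).
  by rewrite finite_setU; split; exact: finite_repr.
apply: sub_finite_set fab => x; rewrite /setY /=.
have [] := pselect (val (repr (cl a)) x); have [] := pselect (val a x);
have [] := pselect (val (repr (cl b)) x); have [] := pselect (val b x); tauto.
Qed.

Lemma clW (P : galgFin -> Prop) : (forall a, P (cl a)) -> forall x, P x.
Proof. by move=> clP' x; rewrite -[x]reprK; exact: clP'. Qed.

Let le (x y : galgFin) := finI x y == x.
Let lt (x y : galgFin) := (y != x) && le x y.

Let finIC : commutative finI.
Proof.
move=> x y; elim/clW: x => a; elim/clW: y => b; rewrite !clI.
by apply: cl_val; rewrite /= setIC.
Qed.

Let finUC : commutative finU.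
Proof.
move=> x y; elim/clW: x => a; elim/clW: y => b; rewrite !clU.
by apply: cl_val; rewrite /= setUC.
Qed.

Let finIA : associative finI.
Proof.
move=> x y z; elim/clW: x => a; elim/clW: y => b; elim/clW: z => c; rewrite !clI.
by apply: cl_val; rewrite /= setIA.
Qed.

Let finUA : associative finU.
Proof.
move=> x y z; elim/clW: x => a; elim/clW: y => b; elim/clW: z => c; rewrite !clU.
by apply: cl_val; rewrite /= setUA.
Qed.

Let finUKI : forall y x, finI x (finU x y) = x.
Proof.
move=> x y; elim/clW: x => b; elim/clW: y => a; rewrite clU clI.
by apply: cl_val; rewrite /= setUC setKU.
Qed.

Let finIKU : forall y x, finU x (finI x y) = x.
Proof.
move=> x y; elim/clW: x => b; elim/clW: y => a; rewrite clI clU.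
by apply: cl_val; rewrite /= setIC setKI.
Qed.

Let finIUl : left_distributive finI finU.
Proof.
move=> x y z; elim/clW: x => a; elim/clW: y => b; elim/clW: z => c; rewrite clU !clI clU.
by apply: cl_val; rewrite /= setIUl.
Qed.

Let finII : idempotent_op finI.
Proof. by move=> x; elim/clW: x => a; rewrite clI; apply: cl_val; rewrite /= setIid. Qed.

Fact galgFin_display : Order.disp_t. Proof. exact: Order.Disp tt tt. Qed.

HB.instance Definition _ := Order.isMeetJoinDistrLattice.Build
  galgFin_display galgFin (fun _ _ => erefl : le _ _ = _)
  (fun _ _ => erefl : lt _ _ = _)
  finIC finUC finIA finUA finUKI finIKU finIUl finII.

Let fin0x (x : galgFin) : (fin0 <= x)%O.
Proof.
apply/eqP; elim/clW: x => a; rewrite [LHS]clI.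
by apply: cl_val; rewrite /= set0I.
Qed.

Let finx1 (x : galgFin) : (x <= fin1)%O.
Proof.
apply/eqP; elim/clW: x => a; rewrite [LHS]clI.
by apply: cl_val; rewrite /= setC0 setIT.
Qed.

HB.instance Definition _ :=
  Order.hasBottom.Build galgFin_display galgFin fin0x.
HB.instance Definition _ :=
  Order.hasTop.Build galgFin_display galgFin finx1.

Let finUxC (x : galgFin) : (x `|` finC x = \top)%O.
Proof.
elim/clW: x => a; rewrite clC [LHS]clU.
by apply: cl_val; rewrite /= setC0 setUv.
Qed.

Let finIxC (x : galgFin) : (x `&` finC x = \bot)%O.
Proof.
by elim/clW: x => a; rewrite clC [LHS]clI; apply: cl_val; rewrite /= setICr.
Qed.

HB.instance Definition _ := Order.TBDistrLattice_hasComplement.Build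
  galgFin_display galgFin finUxC finIxC.

End generated_algebra.

(* S(n) is [xsection S n]; [fset_set] is meaningful only on finite sets, hence
   the explicit finiteness requirement. *)
Definition slaloms : set (set (nat * nat)) :=
  [set S | forall n, finite_set (xsection S n) /\
                     (#|` fset_set (xsection S n)| < 2 ^ n)%N].

Definition calV (R : realType) : set (set (nat * nat)) :=
  [set S | [/\ slaloms S,
    forall n, xsection S n `<=` `I_(2 ^ n) &
    ((#|` fset_set (xsection S n)|%:R / 2 ^+ n : R) @[n --> \oo]
       --> (0 : R))%R]].

Definition box (n : nat) : set (nat * nat) := `I_n `*` `I_(2 ^ n).

Definition Omega : set (set (nat * nat) * nat) :=
  [set p | slaloms p.1 /\ p.1 `<=` box p.2].

(* Ambient algebra: the sets of points of the type [Omega]; an element t has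
   underlying pair [val t] = (T, n). *)
Definition T_set (A : set (nat * nat)) : set Omega :=
  [set t | A `&` box (val t).2 `<=` (val t).1].

Definition T_node (s : Omega) : set Omega :=
  [set t | ((val s).2 <= (val t).2)%N /\
           (val t).1 `&` box (val s).2 = (val s).1].

Definition TV_Fin (R : realType) :=
  galgFin (T_set @` calV R `|` range T_node).
HB.instance Definition _ (R : realType) :=
  Order.CTBDistrLattice.on (TV_Fin R).

(* Main.v *)
Require Import Defs.
From mathcomp Require Import all_boot all_order all_algebra finmap.
From mathcomp Require Import generic_quotient.
From mathcomp Require Import all_classical all_reals all_analysis.
From mathcomp Require Import zify.
Import GRing.Theory Num.Theory.

Set Implicit Arguments.
Unset Strict Implicit.
Unset Printing Implicit Defensive.

Local Open Scope classical_set_scope.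

(* Every infinite member X of the algebra contains some T_t \cap T_A with t in
   T_A, A vanishing and |A(k)| <= 2^k/4 for k at or above the level of t: above
   some level, membership in X depends only on which of finitely many T_B
   contain the point.  As Omega is countable, sort the nonzero elements by such
   a t.  For infinitely many sets A_x with the same t, let L be the limit of the
   A_x along an ultrafilter.  Choose x_0, x_1, ... so that A_{x_j} agrees with L
   below a level past which A_{x_0}, ..., A_{x_{j-1}} together fill at most a
   quarter of each 2^k.  Then finite unions of the A_{x_j} together with L fill
   at most three quarters, so T_t meets all the T_{A_{x_j}} involved in an
   infinite set. *)

(** * Families of finite sets of vanishing density *)

(** The ratio of [#|a k|] to [#|J k|] tends to 0, stated in naturals: [j] is the reciprocal of the
    usual epsilon. *)
Definition vanishing (J : nat -> finType) (a : forall k, {set J k}) : Prop :=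
  forall j, exists n, forall k, n <= k -> j * #|a k| <= #|J k|.

Lemma vanishingU (J : nat -> finType) (a b : forall k, {set J k}) :
  vanishing a -> vanishing b -> vanishing (fun k => a k :|: b k).
Proof.
move=> va vb j; have [n an] := va (2 * j); have [m bm] := vb (2 * j).
exists (maxn n m) => k; rewrite geq_max => /andP[/an ank /bm bmk].
have : #|a k :|: b k| <= #|a k| + #|b k| by rewrite cardsU leq_subr.
nia.
Qed.

Lemma vanishing_bigcup (I : eqType) (J : nat -> finType)
    (a : I -> forall k, {set J k}) (s : seq I) :
  (forall x, x \in s -> vanishing (a x)) ->
  vanishing (fun k => \bigcup_(x <- s) a x k).
Proof.
elim: s => [_ j|x s IH av].
  by exists 0 => k _; rewrite big_nil cards0 muln0.
have /(vanishingU (av _ (mem_head _ _))) :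
    vanishing (fun k => \bigcup_(x <- s) a x k).
  by apply: IH => y ys; apply: av; rewrite inE ys orbT.
by move=> v j; have [n vn] := v j; exists n => k /vn; rewrite big_cons.
Qed.

(** * Limits along an ultrafilter *)

(** Extend the filter [F] of sets containing all but finitely many points of [D]: a set meeting [D]
    finitely has its complement in [F]. *)
Lemma infinite_ultrafilter (T : Type) (D : set T) : infinite_set D ->
  exists2 U : set_system T, UltraFilter U &
    forall B, U B -> infinite_set (D `&` B).
Proof.
move=> Dinf; pose F : set_system T := fun B => finite_set (D `\` B).
have PF : ProperFilter F.
  split; first by rewrite /F setD0.
  split; first by rewrite /F setDT.
  - by move=> A B FA FB; rewrite /F setDIr finite_setU.
  - move=> A B AB; apply: sub_finite_set => x [Dx nBx].
    by split=> // /AB.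
have [U [UU FU]] := ultraFilterLemma PF.
exists U => // B UB fDB; have UC : U (~` B).
  by apply: FU; rewrite /F setDE setCK.
have UBC : U (B `&` ~` B) by exact: filterI.
by have [x []] := filter_ex UBC.
Qed.

(** Otherwise the complements of all fibres of [h] lie in [U]; being finitely many, they would have
    a common point. *)
Lemma ultra_constant (T : Type) (U : set_system T) (J : finType) (h : T -> J) :
  UltraFilter U -> exists j, U [set x | h x = j].
Proof.
move=> UU; apply: contrapT => nU.
have : U [set x | forall j, h x != j].
  apply: filter_forall => j.
  have [Uj|] := in_ultra_setVsetC [set x | h x = j] UU.
    by case: nU; exists j.
  by apply: filterS => x /eqP.
by move=> /filter_ex[x /(_ (h x))]; rewrite eqxx.
Qed.

Lemma bigcup_seq_subset (I : eqType) (J : finType) (f : I -> {set J})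
    (r s : seq I) : {subset r <= s} ->
  \bigcup_(i <- r) f i \subset \bigcup_(i <- s) f i.
Proof.
elim: r => [|i r IH] rs; first by rewrite big_nil finset.sub0set.
rewrite big_cons finset.subUset IH ?andbT; last first.
  by move=> j jr; apply: rs; rewrite inE jr orbT.
by rewrite (big_rem i) ?rs ?mem_head //= finset.subsetUl.
Qed.

Lemma quarters_setU3 (J : finType) (A B C : {set J}) :
  4 * #|A| <= #|J| -> 4 * #|B| <= #|J| -> 4 * #|C| <= #|J| ->
  4 * #|A :|: (B :|: C)| <= 3 * #|J|.
Proof.
have := leq_trans (leq_card_setU A (B :|: C)).1
  (leq_add (leqnn _) (leq_card_setU B C).1).
move: #|A :|: _| #|A| #|B| #|C| #|J| => *; lia.
Qed.

(** * An infinite subfamily with small finite unions *)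

Section thin_subfamily.
Context (T : choiceType) (J : nat -> finType) (a : T -> forall k, {set J k}).
Context (m : nat) (D : set T) (Dinf : infinite_set D).
Context (a_vanishing : forall x, D x -> vanishing (a x)).
Context (a_small :
  forall x, D x -> forall k, m <= k -> 4 * #|a x k| <= #|J k|).

Let union (s : seq T) k := \bigcup_(x <- s) a x k.

Let limit : exists l : forall k, {set J k},
  forall n, infinite_set (D `&` [set x | forall k, k < n -> a x k = l k]).
Proof.
have [U UU Uinf] := infinite_ultrafilter Dinf.
have ul k : {j | U [set x | a x k = j]}.
  exact/cid/ultra_constant.
pose l k := sval (ul k); have lP k : U [set x | a x k = l k] := svalP (ul k).
exists l => n; apply: Uinf.
have : U [set x | forall i : 'I_n, a x i = l i].
  by apply: filter_forall => i; apply: lP.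
by apply: filterS => x lx k kn; apply: (lx (Ordinal kn)).
Qed.

(** The bound does not depend on the length of [F]: once the union at [k] exceeds a quarter, every
    later member equals [l k] there. *)
Lemma thin_subfamily : exists E : set T, [/\ E `<=` D, infinite_set E &
  forall F : seq T, {subset F <= E} -> forall k, m <= k ->
    4 * #|\bigcup_(x <- F) a x k| <= 3 * #|J k|].
Proof.
have [l lD] := limit.
have l_small k : m <= k -> 4 * #|l k| <= #|J k|.
  move=> mk; have /infinite_setN0[x [Dx /(_ k (ltnSn k)) <-]] := lD k.+1.
  exact: a_small.
(* The inclusion in [D] is a premise under the existential, so that [choice] gives a function on all
   sequences. *)
have step (s : seq T) : exists x, [set` s] `<=` D -> [/\ D x, x \notin s &
    forall k, a x k = l k \/ 4 * #|union s k| <= #|J k|].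
  have [sD|nsD] := pselect ([set` s] `<=` D); last first.
    by have /infinite_setN0[x _] := Dinf; exists x.
  have [n sn] := vanishing_bigcup (fun x xs => a_vanishing (sD x xs)) 4.
  have /infinite_setD/(_ (finite_seq s))/infinite_setN0[x [[Dx xl] xs]] := lD n.
  exists x => _; split=> //; first exact/negP.
  by move=> k; have [/sn|/xl] := leqP n k; [right | left].
have [next nextP] := choice step.
pose chain n := iter n (fun s => next s :: s) [::].
have chainD n : [set` chain n] `<=` D.
  elim: n => [|n IH] x //=; rewrite inE => /orP[/eqP->|/IH//].
  by have [] := nextP _ IH.
have chain_mono n p : n <= p -> {subset chain n <= chain p}.
  elim: p => [|p IH]; first by rewrite leqn0 => /eqP->.
  rewrite leq_eqVlt => /predU1P[->//|]; rewrite ltnS => /IH np x /np.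
  by rewrite /= inE => ->; rewrite orbT.
have chain_uniq n : uniq (chain n).
  elim: n => //= n ->; rewrite andbT.
  by have [] := nextP _ (@chainD n).
have chain_size n : size (chain n) = n by elim: n => //= n ->.
(* At index [k] the new member either repeats [l k] or follows a union that
   already occupies at most a quarter. *)
have chain_small n k : m <= k -> 4 * #|l k :|: union (chain n) k| <= 3 * #|J k|.
  move=> mk; elim: n => [|n IH].
    rewrite /union big_nil finset.setU0.
    exact: leq_trans (l_small _ mk) (leq_pmull _ _).
  have [Dx _ /(_ k)] := nextP _ (@chainD n).
  rewrite /= /union big_cons -/(union _ k) => -[->|us].
    by rewrite finset.setUA finset.setUid.
  apply: quarters_setU3 us; [exact: l_small | exact: a_small].
exists [set x | exists n, x \in chain n]; split.
- by move=> x [n /chainD].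
- move=> /finite_fsetP[E EE].
  (* A duplicate-free chain one longer than the size of [E] would lie inside [E]. *)
  have : #|` [fset x in chain (#|` E|).+1]%fset| <= #|` E|.
    apply: fsubset_leq_card; apply/fsubsetP => _ /imfsetP[x /= xc ->].
    by have : [set` E] x by rewrite -EE; exists (#|` E|).+1.
  by rewrite card_fseq undup_id // chain_size ltnn.
- move=> F FE k mk.
  have [n Fn] : exists n, {subset F <= chain n}.
    elim: F FE => [|x F IH] FE; first by exists 0.
    have [|n Fn] := IH; first by move=> y yF; apply: FE; rewrite inE yF orbT.
    have /set_mem[p xp] := FE x (mem_head _ _).
    exists (maxn n p) => y; rewrite inE => /predU1P[->|/Fn yn].
      by apply: chain_mono xp; rewrite leq_maxr.
    by apply: chain_mono yn; rewrite leq_maxl.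
  apply: leq_trans (chain_small n k mk); rewrite leq_mul2l /=.
  apply: subset_leq_card; apply: fintype.subset_trans (finset.subsetUr _ _).
  exact: bigcup_seq_subset.
Qed.
End thin_subfamily.

(** * Levels, sections and extensions of points of [Omega] *)

Definition level (t : Omega) : nat := (val t).2.

(** A copy of [xsection A k] in a finite type, so that finite cardinalities apply; nothing is cut
    off when [below_pow A]. *)
Definition sec (A : set (nat * nat)) (k : nat) : {set 'I_(2 ^ k)} :=
  [set i | `[< A (k, val i) >]].

Lemma in_sec (A : set (nat * nat)) k i : (i \in sec A k) = `[< A (k, val i) >].
Proof. by rewrite inE. Qed.

Definition below_pow (A : set (nat * nat)) : Prop :=
  forall k, xsection A k `<=` `I_(2 ^ k).

Lemma xsectionE (A : set (nat * nat)) k i : xsection A k i = A (k, i).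
Proof. by rewrite propeqE; split=> [/set_mem|/mem_set]. Qed.

Lemma sec_fset_set (A : set (nat * nat)) k : xsection A k `<=` `I_(2 ^ k) ->
  finite_set (xsection A k) /\ #|` fset_set (xsection A k)| = #|sec A k|.
Proof.
move=> Ak; have fA : finite_set (xsection A k).
  by apply: sub_finite_set Ak _; exact: finite_II.
split=> //.
suff -> : fset_set (xsection A k) = [fset val i | i in sec A k]%fset.
  by rewrite card_imfset ?cardE //=; exact: val_inj.
apply/fsetP => i; rewrite in_fset_set // mem_xsection; apply/idP/imfsetP.
  move=> /set_mem Aki; have ik : i < 2 ^ k by apply: Ak; rewrite xsectionE.
  by exists (Ordinal ik) => //=; rewrite in_sec; exact/asboolP.
by move=> [j /= jA ->]; apply: mem_set; apply/asboolP; rewrite -in_sec.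
Qed.

Lemma sec_bigcup (I : eqType) (s : seq I) (A : I -> set (nat * nat)) k :
  sec (\bigcup_(x in [set` s]) A x) k = \bigcup_(x <- s) sec (A x) k.
Proof.
elim: s => [|x s IH].
  rewrite big_nil set_nil bigcup_set0; apply/setP => i.
  by rewrite in_sec finset.in_set0; apply/asboolP.
rewrite big_cons -IH; apply/setP => i.
rewrite finset.in_setU !in_sec; apply/asboolP/orP.
  move=> [y /=]; rewrite inE => /predU1P[->|ys] Ay; [left | right].
    exact/asboolP.
  by apply/asboolP; exists y.
move=> [/asboolP Ax|/asboolP[y ys Ay]]; first by exists x; rewrite //= mem_head.
by exists y; rewrite //= inE ys orbT.
Qed.

Lemma Omega_sub_box (t : Omega) : (val t).1 `<=` box (level t).
Proof. by have /set_mem[] := valP t. Qed.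

Lemma box_mono m n : m <= n -> box m `<=` box n.
Proof.
move=> mn [k i] [/= km im]; split=> /=; first exact: leq_trans km mn.
by apply: leq_trans im _; rewrite leq_exp2l.
Qed.

Lemma below_pow_box (A : set (nat * nat)) k i n :
  below_pow A -> A (k, i) -> k < n -> box n (k, i).
Proof.
move=> Apow Aki kn; split=> //=.
have : i < 2 ^ k by apply: Apow; rewrite xsectionE.
by move=> /leq_trans; apply; rewrite leq_exp2l // ltnW.
Qed.

Lemma slalomsS (S : set (nat * nat)) :
  (forall k, exists C, [/\ xsection S k `<=` C, finite_set C &
    #|` fset_set C| < 2 ^ k]) -> slaloms S.
Proof.
move=> SC k; have [C [SkC Cfin Ck]] := SC k.
have Sfin : finite_set (xsection S k) by exact: sub_finite_set Cfin.
split=> //; apply: leq_ltn_trans Ck; apply: fsubset_leq_card.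
by rewrite -fset_set_sub.
Qed.

(** Add [A] to [t] up to level [n]. Below [level t] this changes nothing, since [t] lies in
    [T_set A]; from there on the section is that of [A], which is not full. *)
Lemma extend_along (t : Omega) (A : set (nat * nat)) n :
    below_pow A -> T_set A t ->
    (forall k, level t <= k -> #|sec A k| < 2 ^ k) -> level t <= n ->
  exists2 u : Omega, (T_node t `&` T_set A) u & level u = n.
Proof.
move=> Apow tA Asmall tn; pose S := (val t).1 `|` (A `&` box n).
have OS : Omega (S, n).
  split=> /=; last first.
    move=> p [/Omega_sub_box|[]//]; exact: box_mono.
  have [tsl _] : Omega (val t) := set_mem (valP t).
  apply: slalomsS => k; have [kt|tk] := ltnP k (level t).
    exists (xsection (val t).1 k); have [tkfin tkcard] := tsl k; split=> // i.
    rewrite !xsectionE => -[//|[Aki _]]; apply: tA; split=> //.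
    exact: below_pow_box.
  have [Afin Acard] := sec_fset_set (Apow k).
  exists (xsection A k); split=> //; last by rewrite Acard; exact: Asmall.
  move=> i; rewrite !xsectionE => -[|[]//] /Omega_sub_box[/= ktt].
  by move: (leq_trans ktt tk); rewrite ltnn.
exists (SigSub (mem_set OS)) => //; split; last by move=> p ?; right.
split=> //=; apply/seteqP; split=> p.
  by move=> [[//|[Ap _]] pt]; apply: tA.
by move=> tp; split; [left | exact: Omega_sub_box].
Qed.

Lemma infinite_extensions (t : Omega) (A : set (nat * nat)) :
    below_pow A -> T_set A t ->
    (forall k, level t <= k -> #|sec A k| < 2 ^ k) ->
  infinite_set (T_node t `&` T_set A).
Proof.
move=> Apow tA Asmall fX; apply: infinite_nat.
apply: (@sub_finite_set _ _ (`I_(level t) `|` level @` (T_node t `&` T_set A))).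
  move=> n _; have [|tn] := ltnP n (level t); first by left.
  by have [u ? <-] := extend_along Apow tA Asmall tn; right; exists u.
by rewrite finite_setU; split; [exact: finite_II | exact: finite_image].
Qed.

(** A point of level below [n] is recovered from its level and its trace on the finite set
    [box n]. *)
Lemma finite_level (n : nat) : finite_set [set t : Omega | level t < n].
Proof.
pose trace (t : Omega) : {set 'I_n * 'I_(2 ^ n)} :=
  finset (fun p : 'I_n * 'I_(2 ^ n) => `[< (val t).1 (val p.1, val p.2) >]).
pose code (t : Omega) : 'I_n.+1 * {set 'I_n * 'I_(2 ^ n)} :=
  (inord (level t), trace t).
have traceP t q : level t < n -> (val t).1 q <->
    exists2 p, p \in trace t & q = (val p.1, val p.2).
  move=> tn; case: q => k i; split=> [tq|[p]]; last first.
    by rewrite inE => /asboolP + ->.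
  have [/= kn i2n] : box n (k, i).
    exact: box_mono (ltnW tn) _ (Omega_sub_box tq).
  by exists (Ordinal kn, Ordinal i2n) => //; rewrite inE; apply/asboolP.
have codeI : {in [set t | level t < n] &, injective code}.
  move=> t u /set_mem tn /set_mem un tu.
  have lvl : level t = level u.
    have := congr1 (fun p => nat_of_ord p.1) tu.
    by rewrite !inordK // ltnS ltnW.
  have tr : trace t = trace u := congr1 snd tu.
  apply/val_inj; rewrite [LHS]surjective_pairing [RHS]surjective_pairing.
  congr pair => //; apply/seteqP; split=> q /traceP => [/(_ tn)|/(_ un)] tq.
    by apply/traceP; rewrite -?tr.
  by apply/traceP; rewrite ?tr.
by rewrite -(eq_finite_set (inj_card_eq codeI)); exact: finite_finset.
Qed.

Lemma countable_Omega : countable [set: Omega].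
Proof.
have -> : [set: Omega] = \bigcup_n [set t : Omega | level t < n].
  by apply/seteqP; split=> // t _; exists (level t).+1 => //=.
apply: bigcup_countable => // n _.
exact/finite_set_countable/finite_level.
Qed.

Lemma ltn_pow2_of_quarters c k : 4 * c <= 3 * 2 ^ k -> c < 2 ^ k.
Proof. by have := expn_gt0 2 k; move: (2 ^ k) => p; lia. Qed.

(** * Sparse sets and the structure of members of the algebra *)

(** Closed under finite unions, unlike [calV]: two members of [calV] may together fill a section,
    and their union is then no slalom. *)
Definition sparse (A : set (nat * nat)) : Prop :=
  below_pow A /\ @vanishing (fun k => 'I_(2 ^ k)) (sec A).

Lemma calV_sparse (R : realType) (A : set (nat * nat)) :
  calV R A -> sparse A.
Proof.
move=> [_ Apow cvgA]; split=> // j.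
(* The threshold uses [j.+1] so that it makes sense for [j = 0]. *)
have j0 : (0 < j.+1%:R^-1 :> R)%R by rewrite invr_gt0 ltr0n.
have /cvgr0Pnorm_lt/(_ _ j0)[N _ AN] := cvgA.
exists N => k Nk; have := AN k Nk.
rewrite /= (sec_fset_set (Apow k)).2 card_ord.
rewrite ger0_norm ?divr_ge0 // ltr_pdivrMr ?exprn_gt0 ?ltr0n //.
rewrite mulrC ltr_pdivlMr ?ltr0n // -natrX -natrM ltr_nat.
by move=> /ltnW; apply: leq_trans; rewrite mulnC leq_mul2l leqnSn orbT.
Qed.

Lemma sparse_bigcup (I : eqType) (s : seq I) (A : I -> set (nat * nat)) :
  (forall i, i \in s -> sparse (A i)) ->
  sparse (\bigcup_(i in [set` s]) A i).
Proof.
move=> An; split.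
  move=> k p; rewrite xsectionE => -[i si Ai]; have [Apow _] := An i si.
  by apply: Apow; rewrite xsectionE.
have v := @vanishing_bigcup _ (fun k => 'I_(2 ^ k)) (fun i => sec (A i)) s
  (fun i si => (An i si).2).
by move=> j; have [n vn] := v j; exists n => k /vn; rewrite sec_bigcup.
Qed.

Lemma secS (A B : set (nat * nat)) k : A `<=` B -> #|sec A k| <= #|sec B k|.
Proof.
move=> AB; apply/subset_leq_card/fintype.subsetP => i.
by rewrite !in_sec => /asboolP/AB/asboolP.
Qed.

Lemma T_setS (A B : set (nat * nat)) : A `<=` B -> T_set B `<=` T_set A.
Proof. by move=> AB t tB p [/AB Bp tp]; apply: tB. Qed.

Lemma T_set_bigcup (I : Type) (D : set I) (A : I -> set (nat * nat))
    (t : Omega) :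
  (forall i, D i -> T_set (A i) t) -> T_set (\bigcup_(i in D) A i) t.
Proof. by move=> tA p [[i Di Ap] tp]; apply: tA Di _ _. Qed.

Lemma T_node_trans (s t u : Omega) : T_node s t -> T_node t u -> T_node s u.
Proof.
move=> [st ts] [tu ut]; split; first exact: leq_trans tu.
by rewrite -ts -ut -setIA (setIidr (box_mono st)).
Qed.

Lemma T_node_box (t u : Omega) p : T_node t u -> box (level t) p ->
  (val t).1 p <-> (val u).1 p.
Proof. by move=> [_ <-] tp; split=> [[]|]. Qed.

(** Extending a point can only lose membership in [T_set A]; hence one implication is enough in the
    premise of [eventually_determined]. *)
Lemma T_node_T_set (A : set (nat * nat)) (t u : Omega) :
  T_node t u -> T_set A u -> T_set A t.
Proof.
move=> tu uA p [Ap tp]; apply/(T_node_box tu tp); apply: uA; split=> //.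
by apply: box_mono tp; case: tu.
Qed.

(* Unlike being a union of meets of literals, this is symmetric in [X] and its
   complement, so that it passes through the generated algebra at once. *)
Definition eventually_determined (R : realType) : set (set Omega) :=
  [set X | exists (L : seq (set (nat * nat))) (N : nat),
    (forall A, A \in L -> calV R A) /\
    forall t u, N <= level t -> T_node t u ->
      (forall A, A \in L -> T_set A t -> T_set A u) -> (X t <-> X u)].

Lemma gen_algebra_eventually_determined (R : realType) (X : set Omega) :
  gen_algebra (T_set @` calV R `|` range T_node) X -> eventually_determined R X.
Proof.
(* By minimality of [gen_algebra] it suffices that the eventually determined sets form an algebra
   containing the generators. *)
apply; split; first split.
- by exists [::], 0; split.
- move=> Y [L [N [LV YL]]]; exists L, N; split=> // t u Nt tu Ltu.
  by split=> nY /(YL _ _ Nt tu Ltu).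
- move=> Y Z [L [N [LV YL]]] [M [P [MV ZM]]].
  exists (L ++ M), (maxn N P); split.
    by move=> A; rewrite mem_cat => /orP[/LV|/MV].
  move=> t u; rewrite geq_max => /andP[Nt Pt] tu LMtu.
  have Y_iff : Y t <-> Y u.
    by apply: YL => // A AL; apply: LMtu; rewrite mem_cat AL.
  have Z_iff : Z t <-> Z u.
    by apply: ZM => // A AM; apply: LMtu; rewrite mem_cat AM orbT.
  by split=> -[/Y_iff|/Z_iff]; [left | right | left | right].
- move=> _ [[A AV <-]|[s _ <-]].
    exists [:: A], 0; split=> [B|t u _ tu /(_ A (mem_head _ _))].
      by rewrite inE => /eqP->.
    by split=> //; exact: T_node_T_set.
  exists [::], (level s); split=> // t u st tu _.
  split=> [/T_node_trans|[su us]]; first exact.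
  split=> //; rewrite -us; apply/seteqP; split=> p [tp sp]; split=> //;
    by apply/(T_node_box tu (box_mono st sp)).
Qed.

Lemma dense_cells (R : realType) (X : set Omega) :
  gen_algebra (T_set @` calV R `|` range T_node) X -> infinite_set X ->
  exists (t : Omega) (A : set (nat * nat)), [/\ sparse A, T_set A t,
    forall k, level t <= k -> 4 * #|sec A k| <= 2 ^ k &
    T_node t `&` T_set A `<=` X].
Proof.
move=> /gen_algebra_eventually_determined[L [N [LV XL]]] Xinf.
(* The quarter bound is secured for all of [L], because the sublist [s] depends on [t], which is
   chosen only after [M]. *)
have [_ /(_ 4)[M LM]] : sparse (\bigcup_(B in [set` L]) B).
  by apply: sparse_bigcup => B /LV/calV_sparse.
have /infinite_setN0[t [Xt /negP]] :=
  infinite_setD Xinf (finite_level (maxn N M)).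
rewrite -leqNgt geq_max => /andP[Nt Mt].
(* Keeping just these [B] puts [t] in [T_set] of their union, and a point of [T_node t] in that
   [T_set] satisfies the premise of [XL]. *)
pose s := [seq B <- L | `[< T_set B t >]].
exists t, (\bigcup_(B in [set` s]) B); split.
- apply: sparse_bigcup => B; rewrite mem_filter => /andP[_].
  by move=> /LV/calV_sparse.
- by apply: T_set_bigcup => B; rewrite /= mem_filter => /andP[/asboolP].
- move=> k tk; have := LM k (leq_trans Mt tk).
  rewrite card_ord; apply: leq_trans.
  rewrite leq_mul2l /=; apply: secS; apply: bigcup_subset => B.
  by rewrite /= mem_filter => /andP[].
- move=> u [tu uA]; apply/(XL _ _ Nt tu) => // B BL tB.
  apply: T_setS uA; apply: (@bigcup_sup _ _ B _ (fun B => B)) => //=.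
  by rewrite mem_filter BL andbT; exact/asboolP.
Qed.

(** * Zero and finite meets in the quotient *)

Section quotient.
Context {T : Type} (G : set (set T)).

Lemma pi_eq0 (a : galg G) :
  \pi_(galgFin G)%qT a = (\bot)%O <-> finite_set (val a).
Proof. by split=> [/clP|fa]; [|apply/clP]; rewrite setY0. Qed.

Lemma repr_eq0 (x : galgFin G) : x = (\bot)%O <-> finite_set (val (repr x)).
Proof. by rewrite -pi_eq0 reprK. Qed.

(** The meet has a representative containing the intersection of the chosen representatives with no
    finite error. *)
Lemma meet_seq_pi (s : seq (galgFin G)) : exists2 a : galg G,
  (\meet_(x <- s) x)%O = \pi_(galgFin G)%qT a &
  forall w, (forall x, x \in s -> val (repr x) w) -> val a w.
Proof.
elim: s => [|x s [a sa aP]].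
  by exists (galgC (galg0 G)); [rewrite big_nil | move=> w _ []].
exists (galgI (repr x) a).
  by rewrite big_cons sa -clI reprK.
move=> w sw; split; first by apply: sw; rewrite mem_head.
by apply: aP => y ys; apply: sw; rewrite inE ys orbT.
Qed.

End quotient.

(* [repr x] matters only modulo finite sets, but it is itself in the algebra, so
   [dense_cells] gives an exact inclusion. *)
Definition cell (R : realType) (t : Omega) : set (TV_Fin R) :=
  [set x | exists A, [/\ sparse A, T_set A t,
    forall k, level t <= k -> 4 * #|sec A k| <= 2 ^ k &
    T_node t `&` T_set A `<=` val (repr x)]].

Arguments cell : clear implicits.

(** * The cells cover the nonzero elements and have the centering property *)

Lemma cells_cover (R : realType) :
  [set x : TV_Fin R | x != (\bot)%O] = \bigcup_t cell R t.
Proof.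
apply/seteqP; split=> x.
  move=> /= /eqP x0; have xinf : infinite_set (val (repr x)) by move/repr_eq0.
  have [t [A tA]] := dense_cells (galgP (repr x)) xinf.
  by exists t => //; exists A.
move=> [t _ [A [[Apow _] tA A4 Ax]]]; apply/eqP => /repr_eq0 xfin.
apply: infinite_extensions Apow tA _ (sub_finite_set Ax xfin) => k /A4.
move=> A4k; apply: ltn_pow2_of_quarters.
exact: leq_trans A4k (leq_pmull _ _).
Qed.

Lemma cell_centered (R : realType) (t : Omega) (D : set (TV_Fin R)) :
  D `<=` cell R t -> infinite_set D ->
  exists E : set (TV_Fin R), [/\ E `<=` D, infinite_set E & centered E].
Proof.
move=> Dt Dinf.
have /choice[A AP] : forall x, exists A, D x -> [/\ sparse A, T_set A t,
    forall k, level t <= k -> 4 * #|sec A k| <= 2 ^ k &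
    T_node t `&` T_set A `<=` val (repr x)].
  by move=> x; have [/Dt[A ?]|] := pselect (D x); [exists A | exists set0].
have [||E [ED Einf Esmall]] := @thin_subfamily (TV_Fin R) (fun k => 'I_(2 ^ k))
    (fun x => sec (A x)) (level t) D Dinf.
- by move=> x /AP[[]].
- by move=> x /AP[_ _ + _] k tk; rewrite card_ord; apply.
exists E; split=> // F FE.
have FA x : x \in F -> _ := fun xF => AP x (ED _ (FE x xF)).
have [a -> aP] := meet_seq_pi F; apply/eqP => /pi_eq0.
(* A common part of all representatives from [F]; it is infinite because the union of the [A x]
   leaves a quarter of each [2 ^ k] free from [level t] on. *)
apply: (@sub_infinite_set _ (T_node t `&` T_set (\bigcup_(x in [set` F]) A x))).
  move=> u [tu uA]; apply: aP => x xF; have [_ _ _] := FA x xF; apply.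
  by split=> //; apply: T_setS uA; exact: bigcup_sup.
apply: infinite_extensions.
- by apply: (sparse_bigcup _).1 => x /FA[].
- by apply: T_set_bigcup => x /FA[].
- move=> k tk; have FE' : {subset F <= E} by move=> x /FE/mem_set.
  apply: ltn_pow2_of_quarters.
  by have := Esmall F FE' k tk; rewrite sec_bigcup card_ord.
Qed.

Theorem theorem5p22 (R : realType) : property_star (TV_Fin R).
Proof.
have /countable_injP[f f_inj] := countable_Omega.
exists (fun n => \bigcup_(t in [set t | f t = n]) cell R t); split.
  rewrite cells_cover; apply/seteqP; split=> x [].
    by move=> t _ tx; exists (f t) => //; exists t.
  by move=> n _ [t _ tx]; exists t.
(* As [f] is injective, the [n]-th class is the one cell whose index [t] is read off from any
   element of [D]. *)
move=> n D Dn Dinf; have /infinite_setN0[x /Dn[t tn _]] := Dinf.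
apply: (@cell_centered R t) Dinf => y /Dn[u un uy].
by rewrite (f_inj t u) ?in_setT // tn un.
Qed.
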